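(* Over $\mathbb{F}_2$: (i) The Hopf algebra $c[B_+]$ admits no quasitriangular structure. (ii) The Hopf algebra $c[B_+]^*$ admits a unique nontrivial quasitriangular structure. This is triangular and inherited from a Grassmann line sub-Hopf algebra, i.e. it has the form $\mathcal{R}=1\otimes1+g\otimes g$ with $1,g$ the basis of a sub-Hopf algebra in which $g$ is primitive and $g^2=0$. (iii) The Hopf algebra $d_{sl_2}$ admits only $2$ quasitriangular structures, both nontrivial but triangular, namely \[\mathcal{R}=1\otimes1+u\otimes w+x\otimes u+(x+w)\otimes(x+w)+\alpha\,u\otimes u;\qquad u=1+s,\quad\alpha\in\{0,1\}.\]
   Context: $c[B_+]$ is the $4$-dimensional Hopf algebra over $\mathbb{F}_2$ generated by commuting $s,y$ with $s^2=1$, $y^2=0$, $\Delta s=s\otimes s$, $\Delta y=y\otimes1+s\otimes y$, $\epsilon(s)=1$, $\epsilon(y)=0$, $Ss=s$, $Sy=sy$. Its dual $c[B_+]^*$ has basis $1,x,w,y$ with $x^2=x$, $xw=y+w$, $wx=yx=y$, $xy=y^2=w^2=yw=wy=0$; $\Delta x=x\otimes1+1\otimes x$, $\Delta w=w\otimes1+1\otimes w$, $\Delta y=y\otimes1+1\otimes y+x\otimes w+w\otimes x$; $\epsilon(x)=\epsilon(y)=\epsilon(w)=0$; $Sx=x$, $Sw=w$, $Sy=y+w$. $d_{sl_2}$ is the $4$-dimensional Hopf algebra over $\mathbb{F}_2$ with basis $1,s,x,w$ and $s^2=1$, $sx=wx=w^2=w$, $xs=1+s+w$, $ws=1+s+x$,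 $sw=xw=x^2=x$; $\Delta s=s\otimes s$, $\Delta x=s\otimes x+x\otimes1$, $\Delta w=1\otimes w+w\otimes s$; $\epsilon(s)=1$, $\epsilon(x)=\epsilon(w)=0$; $Ss=s$, $Sx=w$, $Sw=1+s+x$. A quasitriangular structure on a Hopf algebra $H$ is an invertible $\mathcal{R}\in H\otimes H$ with $(\Delta\otimes\mathrm{id})\mathcal{R}=\mathcal{R}_{13}\mathcal{R}_{23}$, $(\mathrm{id}\otimes\Delta)\mathcal{R}=\mathcal{R}_{13}\mathcal{R}_{12}$ and $\mathcal{R}\,\Delta h=(\Delta^{cop}h)\,\mathcal{R}$ for all $h\in H$, where $\Delta^{cop}$ is $\Delta$ followed by the flip. It is nontrivial if $\mathcal{R}\ne1\otimes1$ and triangular if $\mathcal{R}_{21}\mathcal{R}=1\otimes1$, where $\mathcal{R}_{21}$ is $\mathcal{R}$ with tensor factors flipped. An element $g$ is primitive if $\Delta g=g\otimes1+1\otimes g$. *)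

(* Defs.v *)
From HB Require Import structures.
From mathcomp Require Import all_boot all_order all_algebra.

Set Implicit Arguments.
Unset Strict Implicit.
Unset Printing Implicit Defensive.

Import GRing.Theory.
Local Open Scope ring_scope.

(* The vector space with a basis indexed by I.  The tensor product of          *)
(* vec k I and vec k J is vec k (I * J); triple tensor products are indexed by  *)
(* I * J * K, i.e. (I * J) * K.                                                *)
Notation vec k I := {ffun I -> k^o}.

Reserved Notation "u \ox v" (at level 38, left associativity).

Section Tensor.
Variable k : fieldType.

Definition bvec (I : finType) (i : I) : vec k I := [ffun j => (j == i)%:R].

Definition linext (I : finType) (V : lmodType k) (f : I -> V) (u : vec k I) : V :=
  \sum_i u i *: f i.

Definition tens (I J : finType) (u : vec k I) (v : vec k J) : vec k (I * J)%type :=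
  [ffun p => u p.1 * v p.2].

Definition tmap (I J I' J' : finType) (f : vec k I -> vec k I')
    (g : vec k J -> vec k J') : vec k (I * J)%type -> vec k (I' * J')%type :=
  linext (fun p => tens (f (bvec p.1)) (g (bvec p.2))).

Definition tflip (I J : finType) (u : vec k (I * J)%type) : vec k (J * I)%type :=
  [ffun p => u (p.2, p.1)].

Definition tassoc (I J K : finType) (u : vec k (I * (J * K))%type) :
    vec k (I * J * K)%type :=
  [ffun p => u (p.1.1, (p.1.2, p.2))].

(* An algebra, given by its unit and its structure constants. *)
Record alg (I : finType) := Alg {
  abmul : I -> I -> vec k I;
  aone : vec k I
}.

Definition amul (I : finType) (A : alg I) (u v : vec k I) : vec k I :=
  linext (fun i => linext (fun j => abmul A i j) v) u.

Definition talg (I J : finType) (A : alg I) (B : alg J) : alg (I * J)%type :=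
  Alg (fun p q => tens (abmul A p.1 q.1) (abmul B p.2 q.2))
      (tens (aone A) (aone B)).

Record hopf_data (I : finType) := HopfData {
  halg :> alg I;
  hbcomul : I -> vec k (I * I)%type;
  hbcounit : I -> k;
  hbantip : I -> vec k I
}.

Section Hopf.
Variables (I : finType) (H : hopf_data I).

Definition hcomul : vec k I -> vec k (I * I)%type := linext (hbcomul H).
Definition hcounit : vec k I -> k^o := linext (hbcounit H : I -> k^o).
Definition hantip : vec k I -> vec k I := linext (hbantip H).

Record is_hopf : Prop := IsHopf {
  hmulA : associative (amul H);
  hmul1l : left_id (aone H) (amul H);
  hmul1r : right_id (aone H) (amul H);
  hcomulA : forall a,
    tmap hcomul id (hcomul a) = tassoc (tmap id hcomul (hcomul a));
  hcounitl : forall a,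
    linext (fun p => hcounit (bvec p.1) *: bvec p.2) (hcomul a) = a;
  hcounitr : forall a,
    linext (fun p => hcounit (bvec p.2) *: bvec p.1) (hcomul a) = a;
  hcomulM : forall a b,
    hcomul (amul H a b) = amul (talg H H) (hcomul a) (hcomul b);
  hcomul1 : hcomul (aone H) = tens (aone H) (aone H);
  hcounitM : forall a b, hcounit (amul H a b) = hcounit a * hcounit b;
  hcounit1 : hcounit (aone H) = 1;
  hantipl : forall a,
    linext (fun p => amul H (hantip (bvec p.1)) (bvec p.2)) (hcomul a)
      = hcounit a *: aone H;
  hantipr : forall a,
    linext (fun p => amul H (bvec p.1) (hantip (bvec p.2))) (hcomul a)
      = hcounit a *: aone H
}.
End Hopf.

Record hopfAlg (I : finType) := HopfAlg {
  hdata :> hopf_data I;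
  hopfP : is_hopf hdata
}.

Section Quasitriangular.
Variables (I : finType) (H : hopfAlg I).
Local Notation one := (aone H).
Local Notation H2 := (talg H H).
Local Notation H3 := (talg (talg H H) H).
Implicit Type R : vec k (I * I)%type.

Definition leg12 R : vec k (I * I * I)%type := tens R one.
Definition leg23 R : vec k (I * I * I)%type := tassoc (tens one R).
Definition leg13 R : vec k (I * I * I)%type :=
  [ffun p => R (p.1.1, p.2) * one p.1.2].

Record quasitriangular R : Prop := Quasitriangular {
  qt_inv : exists R', amul H2 R R' = aone H2 /\ amul H2 R' R = aone H2;
  qt_comull : tmap (hcomul H) id R = amul H3 (leg13 R) (leg23 R);
  qt_comulr : tassoc (tmap id (hcomul H) R) = amul H3 (leg13 R) (leg12 R);
  qt_cop : forall h : vec k I,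
    amul H2 R (hcomul H h) = amul H2 (tflip (hcomul H h)) R
}.

Definition nontrivial R : Prop := R <> tens one one.

Definition triangular R : Prop := amul H2 (tflip R) R = tens one one.

Definition primitive (g : vec k I) : Prop :=
  hcomul H g = tens g one + tens one g.

Definition tensv (U V : {vspace vec k I}) : {vspace vec k (I * I)%type} :=
  <<[seq tens u v | u <- vbasis U, v <- vbasis V]>>%VS.

Record sub_hopf (U : {vspace vec k I}) : Prop := SubHopf {
  sub_one : one \in U;
  sub_mul : {in U &, forall a b, amul H a b \in U};
  sub_comul : {in U, forall a, hcomul H a \in tensv U U};
  sub_antip : {in U, forall a, hantip H a \in U}
}.

Record grassmann_line (U : {vspace vec k I}) (g : vec k I) : Prop :=
  GrassmannLine {
    gl_sub : sub_hopf U;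
    gl_basis : basis_of U [:: one; g];
    gl_prim : primitive g;
    gl_sqr : amul H g g = 0
  }.
End Quasitriangular.

(* A perfect pairing <_, _> : K x H -> k identifying the Hopf algebra K with    *)
(* the dual of H; ev j is the functional on H given by the j-th basis vector,   *)
(* as the vector of its values on the basis of H.                              *)
Section Duality.
Variables I J : finType.

Definition pairing (ev : J -> vec k I) (a : vec k J) (h : vec k I) : k^o :=
  \sum_i linext ev a i * h i.

Variables (H : hopf_data I) (K : hopf_data J) (ev : J -> vec k I).
Local Notation ev2 := (fun q => tens (ev q.1) (ev q.2)).

Record is_dual : Prop := IsDual {
  dual_perfect : bijective (linext ev);
  dual_mul : forall a b h,
    pairing ev (amul K a b) h
    = \sum_p linext ev2 (tens a b) p * hcomul H h p;
  dual_comul : forall a g h,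
    \sum_p linext ev2 (hcomul K a) p * tens g h p
    = pairing ev a (amul H g h);
  dual_one : forall h, pairing ev (aone K) h = hcounit H h;
  dual_counit : forall a, pairing ev a (aone H) = hcounit K a;
  dual_antip : forall a h, pairing ev (hantip K a) h = pairing ev a (hantip H h)
}.
End Duality.

End Tensor.

Notation "u \ox v" := (tens u v) : ring_scope.

(* Four-dimensional Hopf algebras over F_2 given by tables; the entry in row i  *)
(* and column j of a multiplication table is the product of the i-th and j-th   *)
(* basis vectors.                                                              *)
Definition b4 (i : nat) (lti4 : (i < 4)%N) : vec 'F_2 'I_4 :=
  bvec 'F_2 (Ordinal lti4).

Definition table_hopf (mul : seq (seq (vec 'F_2 'I_4))) (one : vec 'F_2 'I_4)
    (comul : seq (vec 'F_2 ('I_4 * 'I_4)%type)) (counit : seq 'F_2)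
    (antip : seq (vec 'F_2 'I_4)) : hopf_data 'F_2 'I_4 :=
  HopfData (Alg (fun i j : 'I_4 => nth 0 (nth [::] mul i) j) one)
    (fun i : 'I_4 => nth 0 comul i) (fun i : 'I_4 => nth 0 counit i)
    (fun i : 'I_4 => nth 0 antip i).

(* c[B_+], with basis 1, s, y, sy; the values of the structure maps at sy are     *)
(* the products of those at s and y.                                           *)
Definition cBp_data : hopf_data 'F_2 'I_4 :=
  let e := @b4 0 isT in let s := @b4 1 isT in
  let y := @b4 2 isT in let sy := @b4 3 isT in
  table_hopf
    [:: [:: e ; s ; y ; sy];
        [:: s ; e ; sy; y ];
        [:: y ; sy; 0 ; 0 ];
        [:: sy; y ; 0 ; 0 ]]
    e
    [:: e \ox e; s \ox s; y \ox e + s \ox y; sy \ox s + e \ox sy]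
    [:: 1; 1; 0; 0]
    [:: e; s; sy; y].

(* c[B_+]^*, with basis 1, x, w, y *)
Definition cBpd_data : hopf_data 'F_2 'I_4 :=
  let e := @b4 0 isT in let x := @b4 1 isT in
  let w := @b4 2 isT in let y := @b4 3 isT in
  table_hopf
    [:: [:: e; x; w    ; y];
        [:: x; x; y + w; 0];
        [:: w; y; 0    ; 0];
        [:: y; y; 0    ; 0]]
    e
    [:: e \ox e; x \ox e + e \ox x; w \ox e + e \ox w;
        y \ox e + e \ox y + x \ox w + w \ox x]
    [:: 1; 0; 0; 0]
    [:: e; x; w; y + w].

(* d_{sl_2}, with basis 1, s, x, w *)
Definition dsl2_data : hopf_data 'F_2 'I_4 :=
  let e := @b4 0 isT in let s := @b4 1 isT in
  let x := @b4 2 isT in let w := @b4 3 isT in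
  table_hopf
    [:: [:: e; s        ; x; w];
        [:: s; e        ; w; x];
        [:: x; e + s + w; x; x];
        [:: w; e + s + x; w; w]]
    e
    [:: e \ox e; s \ox s; s \ox x + x \ox e; e \ox w + w \ox s]
    [:: 1; 1; 0; 0]
    [:: e; s; w; e + s + x].

(* For the basis 1, s, x, w of d_{sl_2} *)
Definition dsl2_R (alpha : 'F_2) : vec 'F_2 ('I_4 * 'I_4)%type :=
  let e := @b4 0 isT in let s := @b4 1 isT in
  let x := @b4 2 isT in let w := @b4 3 isT in
  let u := e + s in
  e \ox e + u \ox w + x \ox u + (x + w) \ox (x + w) + alpha *: (u \ox u).

Section LinearExtensionality.
Variable k : fieldType.
Implicit Types I J K : finType.

Lemma linext_linear I (V : lmodType k) (f : I -> V) : linear (linext f).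
Proof.
move=> a u v; rewrite /linext scaler_sumr -big_split; apply: eq_bigr => i _.
by rewrite !ffunE scalerDl scalerA.
Qed.

Lemma linext_bvec I (V : lmodType k) (f : I -> V) i : linext f (bvec k i) = f i.
Proof.
rewrite /linext (bigD1 i) //= ffunE eqxx scale1r big1 ?addr0 // => j ji.
by rewrite ffunE (negPf ji) scale0r.
Qed.

Lemma bvec_sum I (u : vec k I) : u = \sum_i u i *: bvec k i.
Proof.
apply/ffunP => j; rewrite sum_ffunE (bigD1 j) //= big1 => [|i ij].
  by rewrite !ffunE eqxx addr0 /GRing.scale /= mulr1.
by rewrite !ffunE eq_sym (negPf ij) scaler0.
Qed.

Lemma linear_comb I (V : lmodType k) (f : vec k I -> V) :
  linear f -> f =1 linext (fun i => f (bvec k i)).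
Proof.
move=> lf u; rewrite {1}(bvec_sum u) /linext.
have f0 : f 0 = 0.
  have h := lf 1 0 0; rewrite !scale1r !addr0 in h.
  by apply: (addrI (f 0)); rewrite -h addr0.
have: forall r : seq I, f (\sum_(i <- r) u i *: bvec k i)
    = \sum_(i <- r) u i *: f (bvec k i).
  by elim=> [|i r IH]; rewrite ?big_nil // !big_cons lf IH.
exact.
Qed.

Lemma lin_ext I (V : lmodType k) (f g : vec k I -> V) :
  linear f -> linear g -> (forall i, f (bvec k i) = g (bvec k i)) -> f =1 g.
Proof.
move=> lf lg fg u; rewrite (linear_comb lf) (linear_comb lg) /linext.
by apply: eq_bigr => i _; rewrite fg.
Qed.

Lemma linear_comp (U V W : lmodType k) (g : V -> W) (f : U -> V) :
  linear g -> linear f -> linear (fun u => g (f u)).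
Proof. by move=> lg lf a u v; rewrite lf lg. Qed.

Lemma linear_id (U : lmodType k) : linear (fun u : U => u).
Proof. by []. Qed.

Lemma amul_linearl I (A : alg k I) v : linear (fun u => amul A u v).
Proof. exact: linext_linear. Qed.

Lemma amul_linearr I (A : alg k I) u : linear (amul A u).
Proof.
move=> a v w.
have amulE t : amul A u t = \sum_i u i *: linext (abmul A i) t by [].
rewrite !amulE scaler_sumr -big_split; apply: eq_bigr => i _.
by rewrite (linext_linear (abmul A i)) scalerDr !scalerA mulrC.
Qed.

Lemma tens_linearl I J (v : vec k J) : linear (fun u : vec k I => u \ox v).
Proof. by move=> a u w; apply/ffunP => p; rewrite !ffunE mulrDl -mulrA. Qed.

Lemma tens_linearr I J (u : vec k I) : linear (fun v : vec k J => u \ox v).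
Proof. by move=> a v w; apply/ffunP => p; rewrite !ffunE mulrDr mulrCA. Qed.

Lemma tassoc_linear I J K : linear (@tassoc k I J K).
Proof. by move=> a u v; apply/ffunP => p; rewrite !ffunE. Qed.

Lemma tmap_linear I J I' J' (f : vec k I -> vec k I') (g : vec k J -> vec k J') :
  linear (tmap f g).
Proof. exact: linext_linear. Qed.

Lemma scale_linear (U V : lmodType k) (f : U -> k^o) (v : V) :
  linear f -> linear (fun u => f u *: v).
Proof. by move=> lf a u w; rewrite lf scalerDl scalerA. Qed.

Lemma mul_linearl (U : lmodType k) (f : U -> k^o) (c : k) :
  linear f -> linear (fun u => f u * c : k^o).
Proof. by move=> lf a u w; rewrite lf mulrDl -mulrA. Qed.

Lemma mul_linearr (U : lmodType k) (f : U -> k^o) (c : k) :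
  linear f -> linear (fun u => c * f u : k^o).
Proof. by move=> lf a u w; rewrite lf mulrDr mulrCA. Qed.
End LinearExtensionality.

Section BasisCheck.
Variables (k : fieldType) (I : finType) (H : hopf_data k I).
Local Notation b := (bvec k).

Local Ltac lint := first
  [ exact: linear_id | exact: linext_linear | exact: amul_linearl
  | exact: amul_linearr | exact: scale_linear (linext_linear _) ].

Lemma is_hopf_basis :
  (forall i j l, amul H (b i) (amul H (b j) (b l))
                 = amul H (amul H (b i) (b j)) (b l)) ->
  (forall i, amul H (aone H) (b i) = b i) ->
  (forall i, amul H (b i) (aone H) = b i) ->
  (forall i, tmap (hcomul H) id (hcomul H (b i))
             = tassoc (tmap id (hcomul H) (hcomul H (b i)))) ->
  (forall i, linext (fun p => hcounit H (b p.1) *: b p.2) (hcomul H (b i)) = b i) ->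
  (forall i, linext (fun p => hcounit H (b p.2) *: b p.1) (hcomul H (b i)) = b i) ->
  (forall i j, hcomul H (amul H (b i) (b j))
               = amul (talg H H) (hcomul H (b i)) (hcomul H (b j))) ->
  hcomul H (aone H) = aone H \ox aone H ->
  (forall i j, hcounit H (amul H (b i) (b j)) = hcounit H (b i) * hcounit H (b j)) ->
  hcounit H (aone H) = 1 ->
  (forall i, linext (fun p => amul H (hantip H (b p.1)) (b p.2)) (hcomul H (b i))
             = hcounit H (b i) *: aone H) ->
  (forall i, linext (fun p => amul H (b p.1) (hantip H (b p.2))) (hcomul H (b i))
             = hcounit H (b i) *: aone H) ->
  is_hopf H.
Proof.
move=> hA h1l h1r hcA hcl hcr hcM hc1 heM he1 hSl hSr.
pose lc : linear (hcomul H) := linext_linear _.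
pose le : linear (hcounit H) := linext_linear _.
split=> //.
- move=> u v w; move: u; apply: lin_ext => [||i]; try lint.
    exact: linear_comp (amul_linearl _ _) (amul_linearl _ _).
  move: v; apply: lin_ext => [||j].
  + exact: linear_comp (amul_linearr _ _) (amul_linearl _ _).
  + exact: linear_comp (amul_linearl _ _) (amul_linearr _ _).
  move: w; apply: lin_ext => [||l] //; try lint.
  exact: linear_comp (amul_linearr _ _) (amul_linearr _ _).
- by apply: lin_ext => //; lint.
- by apply: lin_ext => //; lint.
- apply: lin_ext => //; first exact: linear_comp (tmap_linear _ _) lc.
  exact: linear_comp (@tassoc_linear _ _ _ _) (linear_comp (tmap_linear _ _) lc).
- by apply: lin_ext => //; exact: linear_comp (linext_linear _) lc.
- by apply: lin_ext => //; exact: linear_comp (linext_linear _) lc.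
- move=> u v; move: u; apply: lin_ext => [||i].
  + exact: linear_comp lc (amul_linearl _ _).
  + exact: linear_comp (amul_linearl _ _) lc.
  move: v; apply: lin_ext => [||j] //.
  + exact: linear_comp lc (amul_linearr _ _).
  + exact: linear_comp (amul_linearr _ _) lc.
- move=> u v; move: u; apply: (@lin_ext k I k^o) => [||i].
  + exact: linear_comp le (amul_linearl _ _).
  + exact: mul_linearl.
  move: v; apply: (@lin_ext k I k^o) => [||j] //.
  + exact: linear_comp le (amul_linearr _ _).
  + exact: mul_linearr.
- apply: lin_ext => //; first exact: linear_comp (linext_linear _) lc.
  exact: scale_linear.
- apply: lin_ext => //; first exact: linear_comp (linext_linear _) lc.
  exact: scale_linear.
Qed.
End BasisCheck.

Section Rules.
Variable k : fieldType.
Implicit Types I J K : finType.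

Lemma linextD I (V : lmodType k) (f : I -> V) u v :
  linext f (u + v) = linext f u + linext f v.
Proof. by have := linext_linear f 1 u v; rewrite !scale1r. Qed.

Lemma linext0 I (V : lmodType k) (f : I -> V) : linext f 0 = 0.
Proof. by rewrite /linext big1 // => i _; rewrite ffunE scale0r. Qed.

Lemma amulDl I (A : alg k I) u v w : amul A (u + v) w = amul A u w + amul A v w.
Proof. exact: linextD. Qed.

Lemma amulDr I (A : alg k I) u v w : amul A u (v + w) = amul A u v + amul A u w.
Proof. by have := amul_linearr A u 1 v w; rewrite !scale1r. Qed.

Lemma amul0l I (A : alg k I) u : amul A 0 u = 0.
Proof. exact: linext0. Qed.

Lemma amul0r I (A : alg k I) u : amul A u 0 = 0.
Proof. by rewrite /amul /linext big1 // => i _; rewrite -/(linext _ _) linext0 scaler0. Qed.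

Lemma amul_bvec I (A : alg k I) i j : amul A (bvec k i) (bvec k j) = abmul A i j.
Proof. by rewrite /amul !linext_bvec. Qed.

Lemma tensDl I J (u v : vec k I) (w : vec k J) :
  (u + v) \ox w = u \ox w + v \ox w.
Proof. by have := tens_linearl w 1 u v; rewrite !scale1r. Qed.

Lemma tensDr I J (u : vec k I) (v w : vec k J) :
  u \ox (v + w) = u \ox v + u \ox w.
Proof. by have := tens_linearr u 1 v w; rewrite !scale1r. Qed.

Lemma tens0l I J (u : vec k J) : (0 : vec k I) \ox u = 0.
Proof. by apply/ffunP => p; rewrite !ffunE mul0r. Qed.

Lemma tens0r I J (u : vec k I) : u \ox (0 : vec k J) = 0.
Proof. by apply/ffunP => p; rewrite !ffunE mulr0. Qed.

Lemma tens_bvec I J (i : I) (j : J) : bvec k i \ox bvec k j = bvec k (i, j).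
Proof.
by apply/ffunP => -[i' j']; rewrite !ffunE /= xpair_eqE -natrM mulnb.
Qed.

Lemma tassocD I J K (u v : vec k (I * (J * K))%type) :
  tassoc (u + v) = tassoc u + tassoc v.
Proof. by apply/ffunP => p; rewrite !ffunE. Qed.

Lemma tassoc_bvec I J K (i : I) (j : J) (l : K) :
  tassoc (bvec k (i, (j, l))) = bvec k (i, j, l).
Proof. by apply/ffunP => -[[i' j'] l']; rewrite !ffunE /= !xpair_eqE andbA. Qed.

Lemma tmapD I J I' J' (f : vec k I -> vec k I') (g : vec k J -> vec k J') u v :
  tmap f g (u + v) = tmap f g u + tmap f g v.
Proof. exact: linextD. Qed.

Lemma tmap_bvec I J I' J' (f : vec k I -> vec k I') (g : vec k J -> vec k J') i j :
  tmap f g (bvec k (i, j)) = f (bvec k i) \ox g (bvec k j).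
Proof. exact: linext_bvec. Qed.
End Rules.

Lemma ord4P (P : 'I_4 -> Prop) :
  P (@Ordinal 4 0 isT) -> P (@Ordinal 4 1 isT) -> P (@Ordinal 4 2 isT) ->
  P (@Ordinal 4 3 isT) -> forall i, P i.
Proof.
move=> P0 P1 P2 P3 [[|[|[|[|//]]]] lti];
  by [rewrite (bool_irrelevance lti isT)].
Qed.


(* Vectors over F_2 represented by the list of basis vectors they sum; the Hopf *)
(* algebra axioms and the duality are decided on these lists.                  *)
Section Reflect.
Implicit Types I J K : finType.

Definition sumb I (l : seq I) : vec 'F_2 I := \sum_(i <- l) bvec 'F_2 i.

Lemma sumb1 I (i : I) : sumb [:: i] = bvec 'F_2 i.
Proof. by rewrite /sumb big_seq1. Qed.

Lemma sumb0 I : sumb [::] = 0 :> vec 'F_2 I.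
Proof. by rewrite /sumb big_nil. Qed.

Lemma sumb_cons I (i : I) l : sumb (i :: l) = bvec 'F_2 i + sumb l.
Proof. by rewrite /sumb big_cons. Qed.

Lemma sumb_cat I (l m : seq I) : sumb (l ++ m) = sumb l + sumb m.
Proof. by rewrite /sumb big_cat. Qed.

Lemma sumbE I (l : seq I) i : sumb l i = (count_mem i l)%:R.
Proof.
elim: l => [|j l IH]; first by rewrite sumb0 ffunE.
by rewrite sumb_cons !ffunE IH /= natrD eq_sym.
Qed.

Lemma F2_odd n : n%:R = (odd n)%:R :> 'F_2.
Proof. by apply: val_inj; rewrite /= !val_Fp_nat // !modn2 oddb. Qed.

Definition veq (T : eqType) (l m : seq T) :=
  all (fun i => ~~ odd (count_mem i (l ++ m))) (l ++ m).

Lemma veqP I (l m : seq I) : veq l m -> sumb l = sumb m.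
Proof.
move=> /allP e; apply/ffunP => i; rewrite !sumbE (F2_odd (count_mem i l)).
rewrite (F2_odd (count_mem i m)).
have: odd (count_mem i (l ++ m)) = false.
  have [/e/negbTE //|/count_memPn ->] := boolP (i \in l ++ m); by [].
by rewrite count_cat oddD => /eqP; rewrite eqbF_neg negb_add => /eqP ->.
Qed.

Definition lext (S T : Type) (g : S -> seq T) (l : seq S) : seq T :=
  flatten (map g l).

Lemma linext_sumb I J (f : I -> vec 'F_2 J) g l :
  (forall i, f i = sumb (g i)) -> linext f (sumb l) = sumb (lext g l).
Proof.
move=> fg; elim: l => [|i l IH]; first by rewrite !sumb0 linext0.
by rewrite sumb_cons linextD linext_bvec IH fg -sumb_cat.
Qed.

Lemma tens_sumb I J (l : seq I) (m : seq J) :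
  sumb l \ox sumb m = sumb [seq (i, j) | i <- l, j <- m].
Proof.
elim: l => [|i l IH]; first by rewrite !sumb0 tens0l.
rewrite sumb_cons tensDl IH sumb_cat; congr (_ + _).
elim: m {IH} => [|j m IH]; first by rewrite !sumb0 tens0r.
by rewrite sumb_cons tensDr tens_bvec IH -sumb_cons.
Qed.

Definition lassoc (S T U : Type) (p : S * (T * U)) : (S * T * U)%type :=
  (p.1, p.2.1, p.2.2).

Lemma tassoc_sumb I J K (l : seq (I * (J * K))%type) :
  tassoc (sumb l) = sumb (map (@lassoc _ _ _) l).
Proof.
elim: l => [|[i [j m]] l IH].
  by rewrite !sumb0; apply/ffunP => p; rewrite !ffunE.
by rewrite /= !sumb_cons tassocD tassoc_bvec IH.
Qed.

Lemma amul_sumb I (A : alg 'F_2 I) g l m :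
  (forall i j, abmul A i j = sumb (g i j)) ->
  amul A (sumb l) (sumb m) = sumb (lext (fun i => lext (g i) m) l).
Proof. by move=> Ag; apply: linext_sumb => i; apply: linext_sumb. Qed.

Lemma linextk_sumb I (f : I -> ('F_2)^o) g l :
  (forall i, f i = (g i)%:R) -> linext f (sumb l) = (sumn (map g l))%:R.
Proof.
move=> fg; elim: l => [|i l IH]; first by rewrite sumb0 linext0.
by rewrite sumb_cons linextD linext_bvec IH fg natrD.
Qed.

Lemma scale_sumb I n (l : seq I) :
  (n%:R : 'F_2) *: sumb l = sumb (if odd n then l else [::]).
Proof. by rewrite F2_odd; case: odd; rewrite ?scale1r // scale0r sumb0. Qed.

Lemma pairing_sumb I J (ev : J -> vec 'F_2 I) g l m :
  (forall j, ev j = sumb (g j)) ->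
  pairing ev (sumb l) (sumb m)
  = (sumn [seq count_mem i (lext g l) | i <- m])%:R.
Proof.
move=> eg; rewrite /pairing (linext_sumb l eg).
elim: m => [|i m IH].
  by rewrite sumb0 big1 // => i _; rewrite ffunE mulr0.
rewrite sumb_cons /= natrD -IH -sumbE (bigD1 i) //= [in RHS](bigD1 i) //= addrA.
congr (_ + _); first by rewrite !ffunE eqxx mulrDr mulr1.
by apply: eq_bigr => j ji; rewrite !ffunE (negPf ji) add0r.
Qed.

Section HopfCheck.
Variables (I : finType) (H : hopf_data 'F_2 I) (e : seq I).
Variables (gm : I -> I -> seq I) (g1 : seq I) (gc : I -> seq (I * I)%type).
Variables (ge : I -> nat) (gs : I -> seq I).

Record presented : Prop := Presented {
  pe : forall i, i \in e;
  pm : forall i j, abmul H i j = sumb (gm i j);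
  p1 : aone H = sumb g1;
  pc : forall i, hbcomul H i = sumb (gc i);
  pp : forall i, hbcounit H i = (ge i)%:R;
  ps : forall i, hbantip H i = sumb (gs i)
}.

Definition lmul l m := lext (fun i => lext (gm i) m) l.
Definition lmul2 l m := lext (fun p : I * I => lext (fun q : I * I =>
  [seq (i, j) | i <- gm p.1 q.1, j <- gm p.2 q.2]) m) l.
Definition leps l := sumn (map ge l).

Definition hopf_check : bool :=
  let c := lext gc in let s := lext gs in [&&
  all (fun i => all (fun j => all (fun l =>
    veq (lmul [:: i] (lmul [:: j] [:: l])) (lmul (lmul [:: i] [:: j]) [:: l]))
    e) e) e,
  all (fun i => veq (lmul g1 [:: i]) [:: i]) e,
  all (fun i => veq (lmul [:: i] g1) [:: i]) e,
  all (fun i => veq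
    (lext (fun p => [seq (a, b) | a <- c [:: p.1], b <- [:: p.2]]) (c [:: i]))
    (map (@lassoc _ _ _)
    (lext (fun p => [seq (a, b) | a <- [:: p.1], b <- c [:: p.2]]) (c [:: i])))) e,
  all (fun i => veq
    (lext (fun p => if odd (leps [:: p.1]) then [:: p.2] else [::]) (c [:: i]))
    [:: i]) e,
  all (fun i => veq
    (lext (fun p => if odd (leps [:: p.2]) then [:: p.1] else [::]) (c [:: i]))
    [:: i]) e,
  all (fun i => all (fun j =>
    veq (c (lmul [:: i] [:: j])) (lmul2 (c [:: i]) (c [:: j]))) e) e,
  veq (c g1) [seq (i, j) | i <- g1, j <- g1],
  all (fun i => all (fun j => odd (leps (lmul [:: i] [:: j]))
    == odd (leps [:: i] * leps [:: j])) e) e,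
  odd (leps g1),
  all (fun i => veq (lext (fun p => lmul (s [:: p.1]) [:: p.2]) (c [:: i]))
    (if odd (leps [:: i]) then g1 else [::])) e &
  all (fun i => veq (lext (fun p => lmul [:: p.1] (s [:: p.2])) (c [:: i]))
    (if odd (leps [:: i]) then g1 else [::])) e].

Hypothesis P : presented.

Lemma hmul_sumb l m : amul H (sumb l) (sumb m) = sumb (lmul l m).
Proof. exact: amul_sumb (pm P). Qed.

Lemma hmul2_sumb l m : amul (talg H H) (sumb l) (sumb m) = sumb (lmul2 l m).
Proof. by apply: amul_sumb => p q; rewrite /= !(pm P) tens_sumb. Qed.

Lemma hcomul_sumb l : hcomul H (sumb l) = sumb (lext gc l).
Proof. exact: linext_sumb (pc P). Qed.

Lemma hantip_sumb l : hantip H (sumb l) = sumb (lext gs l).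
Proof. exact: linext_sumb (ps P). Qed.

Lemma hcounit_sumb l : hcounit H (sumb l) = (leps l)%:R.
Proof. exact: linextk_sumb (pp P). Qed.

Lemma hopf_checkP : hopf_check -> is_hopf H.
Proof.
case/and5P=> cA c1l c1r cC /and5P[cel cer cM c1 /and4P[ceM ce1 cSl cSr]].
have al (Q : pred I) : all Q e -> forall i, Q i.
  by move=> /allP q i; apply: q; exact: pe P i.
apply: is_hopf_basis; rewrite ?(p1 P).
- move=> i j l; rewrite -!sumb1 !hmul_sumb; apply: veqP.
  exact: (al _ (al _ (al _ cA i) j) l).
- by move=> i; rewrite -sumb1 hmul_sumb; apply: veqP; exact: (al _ c1l i).
- by move=> i; rewrite -sumb1 hmul_sumb; apply: veqP; exact: (al _ c1r i).
- move=> i; rewrite -sumb1 hcomul_sumb.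
  have t1 p : hcomul H (bvec 'F_2 p.1) \ox bvec 'F_2 p.2
    = sumb [seq (a, b) | a <- lext gc [:: p.1], b <- [:: p.2 : I]].
    by rewrite -!sumb1 hcomul_sumb tens_sumb.
  have t2 p : bvec 'F_2 p.1 \ox hcomul H (bvec 'F_2 p.2)
    = sumb [seq (a, b) | a <- [:: p.1 : I], b <- lext gc [:: p.2]].
    by rewrite -!sumb1 hcomul_sumb tens_sumb.
  rewrite /tmap (linext_sumb _ t1) (linext_sumb _ t2) tassoc_sumb; apply: veqP.
  exact: (al _ cC i).
- move=> i; rewrite -sumb1 hcomul_sumb.
  rewrite (linext_sumb (g := fun p : I * I =>
    if odd (leps [:: p.1]) then [:: p.2] else [::])).
    by apply: veqP; exact: (al _ cel i).
  by move=> p; rewrite -!sumb1 hcounit_sumb scale_sumb.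
- move=> i; rewrite -sumb1 hcomul_sumb.
  rewrite (linext_sumb (g := fun p : I * I =>
    if odd (leps [:: p.2]) then [:: p.1] else [::])).
    by apply: veqP; exact: (al _ cer i).
  by move=> p; rewrite -!sumb1 hcounit_sumb scale_sumb.
- move=> i j; rewrite -!sumb1 hmul_sumb !hcomul_sumb hmul2_sumb; apply: veqP.
  exact: (al _ (al _ cM i) j).
- by rewrite hcomul_sumb tens_sumb; apply: veqP.
- move=> i j; rewrite -!sumb1 hmul_sumb !hcounit_sumb -natrM F2_odd.
  by rewrite (eqP (al _ (al _ ceM i) j)) -F2_odd.
- by rewrite hcounit_sumb F2_odd ce1.
- move=> i; rewrite -sumb1 hcomul_sumb hcounit_sumb scale_sumb.
  rewrite (linext_sumb (g := fun p : I * I => lmul (lext gs [:: p.1]) [:: p.2])).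
    by apply: veqP; exact: (al _ cSl i).
  by move=> p; rewrite -!sumb1 hantip_sumb hmul_sumb.
- move=> i; rewrite -sumb1 hcomul_sumb hcounit_sumb scale_sumb.
  rewrite (linext_sumb (g := fun p : I * I => lmul [:: p.1] (lext gs [:: p.2]))).
    by apply: veqP; exact: (al _ cSr i).
  by move=> p; rewrite -!sumb1 hantip_sumb hmul_sumb.
Qed.
End HopfCheck.
End Reflect.

Definition all4 : seq 'I_4 :=
  [:: @Ordinal 4 0 isT; @Ordinal 4 1 isT; @Ordinal 4 2 isT; @Ordinal 4 3 isT].

Definition o4 (i : nat) : 'I_4 := nth (@Ordinal 4 0 isT) all4 i.

Definition tab1 (t : seq (seq nat)) (i : 'I_4) : seq 'I_4 :=
  map o4 (nth [::] t i).
Definition tab2 (t : seq (seq (seq nat))) (i j : 'I_4) : seq 'I_4 :=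
  map o4 (nth [::] (nth [::] t i) j).
Definition tabc (t : seq (seq (nat * nat))) (i : 'I_4) : seq ('I_4 * 'I_4) :=
  map (fun p => (o4 p.1, o4 p.2)) (nth [::] t i).

Ltac present := split;
  [ by apply: ord4P | apply: ord4P; apply: ord4P
  | | apply: ord4P | apply: ord4P | apply: ord4P ];
  rewrite /= /tab1 /tab2 /tabc /= /b4 /o4 /= ?sumb_cons ?sumb0 ?addr0
    ?tens_bvec ?addrA //.

Lemma cBp_presented : presented cBp_data all4
  (tab2 [:: [:: [:: 0]; [:: 1]; [:: 2]; [:: 3]];
            [:: [:: 1]; [:: 0]; [:: 3]; [:: 2]];
            [:: [:: 2]; [:: 3]; [::]; [::]];
            [:: [:: 3]; [:: 2]; [::]; [::]]]%N)
  [:: o4 0]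
  (tabc [:: [:: (0, 0)]; [:: (1, 1)]; [:: (2, 0); (1, 2)];
            [:: (3, 1); (0, 3)]]%N)
  (fun i => nth 0%N [:: 1; 1; 0; 0]%N i)
  (tab1 [:: [:: 0]; [:: 1]; [:: 3]; [:: 2]]%N).
Proof. present. Qed.

Lemma cBpd_presented : presented cBpd_data all4
  (tab2 [:: [:: [:: 0]; [:: 1]; [:: 2]; [:: 3]];
            [:: [:: 1]; [:: 1]; [:: 3; 2]; [::]];
            [:: [:: 2]; [:: 3]; [::]; [::]];
            [:: [:: 3]; [:: 3]; [::]; [::]]]%N)
  [:: o4 0]
  (tabc [:: [:: (0, 0)]; [:: (1, 0); (0, 1)]; [:: (2, 0); (0, 2)];
            [:: (3, 0); (0, 3); (1, 2); (2, 1)]]%N)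
  (fun i => nth 0%N [:: 1; 0; 0; 0]%N i)
  (tab1 [:: [:: 0]; [:: 1]; [:: 2]; [:: 3; 2]]%N).
Proof. present. Qed.

Lemma dsl2_presented : presented dsl2_data all4
  (tab2 [:: [:: [:: 0]; [:: 1]; [:: 2]; [:: 3]];
            [:: [:: 1]; [:: 0]; [:: 3]; [:: 2]];
            [:: [:: 2]; [:: 0; 1; 3]; [:: 2]; [:: 2]];
            [:: [:: 3]; [:: 0; 1; 2]; [:: 3]; [:: 3]]]%N)
  [:: o4 0]
  (tabc [:: [:: (0, 0)]; [:: (1, 1)]; [:: (1, 2); (2, 0)];
            [:: (0, 3); (3, 1)]]%N)
  (fun i => nth 0%N [:: 1; 1; 0; 0]%N i)
  (tab1 [:: [:: 0]; [:: 1]; [:: 3]; [:: 0; 1; 2]]%N).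
Proof. present. Qed.

Lemma cBp_hopf : is_hopf cBp_data.
Proof. by apply: (hopf_checkP cBp_presented); vm_compute. Qed.

Definition cBp : hopfAlg 'F_2 'I_4 := HopfAlg cBp_hopf.

Lemma cBpd_hopf : is_hopf cBpd_data.
Proof. by apply: (hopf_checkP cBpd_presented); vm_compute. Qed.

Definition cBpd : hopfAlg 'F_2 'I_4 := HopfAlg cBpd_hopf.

Lemma dsl2_hopf : is_hopf dsl2_data.
Proof. by apply: (hopf_checkP dsl2_presented); vm_compute. Qed.

Definition dsl2 : hopfAlg 'F_2 'I_4 := HopfAlg dsl2_hopf.

(* The values of the basis 1, x, w, y of c[B_+]^* on the basis 1, s, y, sy of   *)
(* c[B_+]; in particular 1 is the counit.                                      *)
Definition cBpd_eval (j : 'I_4) : vec 'F_2 'I_4 :=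
  let e := @b4 0 isT in let s := @b4 1 isT in
  let y := @b4 2 isT in let sy := @b4 3 isT in
  nth 0 [:: e + s; s; y + sy; sy] j.

Section PairingLinear.
Variables (k : fieldType) (I J : finType) (ev : J -> vec k I).

Lemma pairing_linearl h : linear (fun a => pairing ev a h).
Proof.
move=> c a b; rewrite /pairing (linext_linear ev).
rewrite -[RHS]/(c * _ + _) mulr_sumr -big_split /=.
by apply: eq_bigr => i _; rewrite !ffunE mulrDl -mulrA.
Qed.

Lemma pairing_linearr a : linear (pairing ev a).
Proof.
move=> c g h; rewrite /pairing -[RHS]/(c * _ + _) mulr_sumr -big_split /=.
by apply: eq_bigr => i _; rewrite !ffunE mulrDr mulrCA.
Qed.
End PairingLinear.

Section DualCheck.
Variables (I J : finType) (H : hopf_data 'F_2 I) (K : hopf_data 'F_2 J).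
Variables (e : seq I) (gm : I -> I -> seq I) (g1 : seq I).
Variables (gc : I -> seq (I * I)%type) (ge : I -> nat) (gs : I -> seq I).
Variables (f : seq J) (hm : J -> J -> seq J) (h1 : seq J).
Variables (hc : J -> seq (J * J)%type) (he : J -> nat) (hs : J -> seq J).
Variables (ev : J -> vec 'F_2 I) (gv : J -> seq I) (giv : I -> seq J).
Hypothesis PH : presented H e gm g1 gc ge gs.
Hypothesis PK : presented K f hm h1 hc he hs.
Hypothesis evE : forall j, ev j = sumb (gv j).

Definition lpair (T U : eqType) (g : U -> seq T) (l : seq U) (m : seq T) : bool :=
  odd (sumn [seq count_mem i (lext g l) | i <- m]).

Definition gv2 (q : J * J) : seq (I * I)%type :=
  [seq (a, b) | a <- gv q.1, b <- gv q.2].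

Definition dual_check : bool := [&&
  all (fun j => veq (lext giv (lext gv [:: j])) [:: j]) f,
  all (fun i => veq (lext gv (lext giv [:: i])) [:: i]) e,
  all (fun a => all (fun b => all (fun h =>
    lpair gv (lmul hm [:: a] [:: b]) [:: h]
    == lpair gv2 [seq (x, y) | x <- [:: a], y <- [:: b]] (lext gc [:: h])) e) f) f,
  all (fun a => all (fun g => all (fun h =>
    lpair gv2 (lext hc [:: a]) [seq (x, y) | x <- [:: g], y <- [:: h]]
    == lpair gv [:: a] (lmul gm [:: g] [:: h])) e) e) f,
  all (fun h => lpair gv h1 [:: h] == odd (leps ge [:: h])) e,
  all (fun a => lpair gv [:: a] g1 == odd (leps he [:: a])) f &
  all (fun a => all (fun h => lpair gv (lext hs [:: a]) [:: h]
    == lpair gv [:: a] (lext gs [:: h])) e) f].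

Local Notation lin2 := (@lin_ext 'F_2 _ ('F_2)^o).

Lemma dual_checkP : dual_check -> is_dual H K ev.
Proof.
case/and5P=> c1 c2 cm cc /and3P[ci ce cs].
have al (T : eqType) (r : seq T) (Q : pred T) :
    all Q r -> (forall i, i \in r) -> forall i, Q i.
  by move=> /allP q re i; apply: q.
have pE l m : pairing ev (sumb l) (sumb m) = (lpair gv l m)%:R.
  by rewrite (pairing_sumb _ _ evE) F2_odd.
have ev2E q : ev q.1 \ox ev q.2 = sumb (gv2 q) by rewrite !evE tens_sumb.
have p2E l m : pairing (fun q => ev q.1 \ox ev q.2) (sumb l) (sumb m)
    = (lpair gv2 l m)%:R.
  by rewrite (pairing_sumb _ _ ev2E) F2_odd.
have eI := pe PH; have fJ := pe PK.
pose plr (A B : finType) (v : B -> vec 'F_2 A) := pairing_linearr v.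
pose lcH : linear (hcomul H) := linext_linear _.
pose lcK : linear (hcomul K) := linext_linear _.
split.
- exists (linext (fun i => sumb (giv i))).
    apply: lin_ext => [||j]; last 1 first.
    + rewrite -sumb1 (linext_sumb _ evE) (linext_sumb (g := giv)) //.
      by apply: veqP; exact: (al _ _ _ c1 fJ j).
    + exact: linear_comp (linext_linear _) (linext_linear _).
    + exact: linear_id.
  apply: lin_ext => [||i]; last 1 first.
  + rewrite -sumb1 (linext_sumb (g := giv)) // (linext_sumb _ evE).
    by apply: veqP; exact: (al _ _ _ c2 eI i).
  + exact: linear_comp (linext_linear _) (linext_linear _).
  + exact: linear_id.
- move=> a b h; rewrite -/(pairing (fun q => ev q.1 \ox ev q.2) _ _).
  move: a; apply: lin2 => [||a].
  + exact: linear_comp (pairing_linearl _ _) (amul_linearl _ _).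
  + exact: linear_comp (pairing_linearl _ _) (tens_linearl _).
  move: b; apply: lin2 => [||b].
  + exact: linear_comp (pairing_linearl _ _) (amul_linearr _ _).
  + exact: linear_comp (pairing_linearl _ _) (tens_linearr _).
  move: h; apply: lin2 => [||h].
  + exact: plr.
  + exact: linear_comp (plr _ _ _ _) lcH.
  rewrite -!sumb1 (hmul_sumb PK) (hcomul_sumb PH) tens_sumb pE p2E.
  by rewrite (eqP (al _ _ _ (al _ _ _ (al _ _ _ cm fJ a) fJ b) eI h)).
- move=> a g h; rewrite -/(pairing (fun q => ev q.1 \ox ev q.2) _ _).
  move: a; apply: lin2 => [||a].
  + exact: linear_comp (pairing_linearl _ _) lcK.
  + exact: pairing_linearl.
  move: g; apply: lin2 => [||g].
  + exact: linear_comp (plr _ _ _ _) (tens_linearl _).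
  + exact: linear_comp (plr _ _ _ _) (amul_linearl _ _).
  move: h; apply: lin2 => [||h].
  + exact: linear_comp (plr _ _ _ _) (tens_linearr _).
  + exact: linear_comp (plr _ _ _ _) (amul_linearr _ _).
  rewrite -!sumb1 (hcomul_sumb PK) (hmul_sumb PH) tens_sumb pE p2E.
  by rewrite (eqP (al _ _ _ (al _ _ _ (al _ _ _ cc fJ a) eI g) eI h)).
- apply: lin2 => [||h]; [exact: plr | exact: linext_linear |].
  rewrite (p1 PK) -sumb1 (hcounit_sumb PH) pE [RHS]F2_odd.
  by rewrite (eqP (al _ _ _ ci eI h)).
- apply: lin2 => [||a]; [exact: pairing_linearl | exact: linext_linear |].
  rewrite (p1 PH) -sumb1 (hcounit_sumb PK) pE [RHS]F2_odd.
  by rewrite (eqP (al _ _ _ ce fJ a)).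
- move=> a h; move: a; apply: lin2 => [||a].
  + exact: linear_comp (pairing_linearl _ _) (linext_linear _).
  + exact: pairing_linearl.
  move: h; apply: lin2 => [||h].
  + exact: plr.
  + exact: linear_comp (plr _ _ _ _) (linext_linear _).
  rewrite -!sumb1 (hantip_sumb PK) (hantip_sumb PH) !pE.
  by rewrite (eqP (al _ _ _ (al _ _ _ cs fJ a) eI h)).
Qed.
End DualCheck.

Lemma cBpd_dual : is_dual cBp cBpd cBpd_eval.
Proof.
apply: (dual_checkP (gv := tab1 [:: [:: 0; 1]; [:: 1]; [:: 2; 3]; [:: 3]]%N)
  (giv := tab1 [:: [:: 0; 1]; [:: 1]; [:: 2; 3]; [:: 3]]%N)
  cBp_presented cBpd_presented).
  by apply: ord4P; rewrite /= /tab1 /cBpd_eval /= /b4 /o4 /= ?sumb_cons ?sumb0 ?addr0.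
by vm_compute.
Qed.

(* Main.v *)
(* Write R = sum_i e_i (x) r_i = sum_j c_j (x) e_j in a basis (e_i) of H.  The   *)
(* axiom on (Delta (x) id) R says that the rows r_i multiply in H as the dual   *)
(* basis does in H^*, the axiom on (id (x) Delta) R that the columns c_j do so  *)
(* in H^op, and the remaining axiom R Delta = Delta^cop R is linear in R.  Over *)
(* F_2 a row takes 16 values, and choosing the rows one after the other while   *)
(* the relations between those already chosen hold leaves at most a few dozen   *)
(* tables.  For each of the three algebras, the only table that passes all      *)
(* tests and is neither 1 (x) 1 nor a claimed structure is R = 0, which is not  *)
(* invertible.  Conversely, R_21 is the inverse of a triangular R.              *)
Require Import Defs.
From HB Require Import structures.
From mathcomp Require Import all_boot all_order all_algebra.
Import GRing.Theory.
Local Open Scope ring_scope.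

Set Implicit Arguments.
Unset Strict Implicit.
Unset Printing Implicit Defensive.

(** An element [R] of H (x) H is the same as a linear map from the dual H^* to H, phi -> (phi (x)
    id) R. The first coproduct axiom says that this map is multiplicative, the second that phi ->
    (id (x) phi) R reverses products; on the dual basis these are quadratic equations on the rows
    and the columns of [R] ([comull_rows], [comulr_rows]). The third axiom need only be tested on
    basis vectors ([cop_basis]). Over F_2 a vector is a set of basis vectors, so the equations
    become decidable statements on finite tables, and a pruned enumeration reaches every solution
    ([quasitriangular_candidates]). Invertibility enters the exclusion only through R <> 0
    ([quasitriangular_search]), and the claimed structures are confirmed by the same tests together
    with triangularity, which supplies the inverse ([quasitriangular_check]). What remains is one
    evaluation per algebra, and the check that 1 and w span a Grassmann line in c[B_+]^*
    ([w_grassmann_line]). *)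

(** * Multilinear algebra of tensors, flips and spans *)

Section Linear.
Variable k : fieldType.
Implicit Types (I J : finType) (V W : lmodType k).

Lemma linear_sumZ V W (f : V -> W) (T : Type) (r : seq T) (a : T -> k) v :
  linear f -> f (\sum_(i <- r) a i *: v i) = \sum_(i <- r) a i *: f (v i).
Proof.
move=> lf; elim: r => [|i r IH]; last by rewrite !big_cons lf IH.
have h := lf 1 0 0; rewrite !scale1r !addr0 in h.
by rewrite !big_nil; apply: (addrI (f 0)); rewrite -h addr0.
Qed.

Lemma linear_big_sum V W (f : V -> W) (T : Type) (r : seq T) v :
  linear f -> f (\sum_(i <- r) v i) = \sum_(i <- r) f (v i).
Proof.
move=> lf; have := linear_sumZ r (fun=> 1) v lf.
by under eq_bigr do rewrite scale1r; under [RHS]eq_bigr do rewrite scale1r.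
Qed.

Lemma amul_tens I J (A : alg k I) (B : alg k J) a b c d :
  amul (talg A B) (a \ox b) (c \ox d) = amul A a c \ox amul B b d.
Proof.
move: a; apply: lin_ext => [||i].
- exact: linear_comp (amul_linearl _ _) (tens_linearl _).
- exact: linear_comp (tens_linearl _) (amul_linearl _ _).
move: c; apply: lin_ext => [||i'].
- exact: linear_comp (amul_linearr _ _) (tens_linearl _).
- exact: linear_comp (tens_linearl _) (amul_linearr _ _).
move: b; apply: lin_ext => [||j].
- exact: linear_comp (amul_linearl _ _) (tens_linearr _).
- exact: linear_comp (tens_linearr _) (amul_linearl _ _).
move: d; apply: lin_ext => [||j'].
- exact: linear_comp (amul_linearr _ _) (tens_linearr _).
- exact: linear_comp (tens_linearr _) (amul_linearr _ _).
by rewrite !tens_bvec !amul_bvec.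
Qed.

Lemma tmap_tens I J I' J' (f : vec k I -> vec k I')
    (g : vec k J -> vec k J') u v :
  linear f -> linear g -> tmap f g (u \ox v) = f u \ox g v.
Proof.
move=> lf lg; move: u; apply: lin_ext => [||i].
- exact: linear_comp (tmap_linear _ _) (tens_linearl _).
- exact: linear_comp (tens_linearl _) lf.
move: v; apply: lin_ext => [||j].
- exact: linear_comp (tmap_linear _ _) (tens_linearr _).
- exact: linear_comp (tens_linearr _) lg.
by rewrite tens_bvec tmap_bvec.
Qed.

Lemma tflip_linear I J : linear (@tflip k I J).
Proof. by move=> a u v; apply/ffunP => p; rewrite !ffunE. Qed.

(** This turns R_21 R = 1 into R R_21 = 1, so that triangularity gives a two-sided inverse. *)
Lemma tflip_amul I (A : alg k I) (u v : vec k (I * I)%type) :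
  tflip (amul (talg A A) u v) = amul (talg A A) (tflip u) (tflip v).
Proof.
have lt := @tflip_linear I I.
move: u; apply: lin_ext => [||[i j]].
- exact: linear_comp lt (amul_linearl _ _).
- exact: linear_comp (amul_linearl _ _) lt.
move: v; apply: lin_ext => [||[i' j']].
- exact: linear_comp lt (amul_linearr _ _).
- exact: linear_comp (amul_linearr _ _) lt.
have tf (a b : vec k I) : tflip (a \ox b) = b \ox a.
  by apply/ffunP => p; rewrite !ffunE mulrC.
by rewrite -!tens_bvec amul_tens !tf amul_tens.
Qed.

Definition tens_row I J (R : vec k (I * J)%type) (i : I) : vec k J :=
  [ffun j => R (i, j)].

Lemma sum_bvec_tens I J (f : I -> vec k J) i j :
  (\sum_m bvec k m \ox f m) (i, j) = f i j.
Proof.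
rewrite sum_ffunE (bigD1 i) //= big1 => [|m mi].
  by rewrite !ffunE /= eqxx mul1r addr0.
by rewrite !ffunE /= eq_sym (negPf mi) mul0r.
Qed.

Lemma sum_tens_bvec I J (f : J -> vec k I) i j :
  (\sum_m f m \ox bvec k m) (i, j) = f j i.
Proof.
rewrite sum_ffunE (bigD1 j) //= big1 => [|m mj].
  by rewrite !ffunE /= eqxx mulr1 addr0.
by rewrite !ffunE /= eq_sym (negPf mj) mulr0.
Qed.

Lemma sum_rows I J (R : vec k (I * J)%type) :
  R = \sum_i bvec k i \ox tens_row R i.
Proof. by apply/ffunP => -[i j]; rewrite sum_bvec_tens ffunE. Qed.

Lemma sum_cols I J (R : vec k (I * J)%type) :
  R = \sum_j tens_row (tflip R) j \ox bvec k j.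
Proof. by apply/ffunP => -[i j]; rewrite sum_tens_bvec !ffunE. Qed.

Lemma mem_tensv I (U V : {vspace vec k I}) u v :
  u \in U -> v \in V -> u \ox v \in tensv U V.
Proof.
move=> uU vV; rewrite (coord_vbasis uU) (coord_vbasis vV).
rewrite (linear_sumZ _ _ _ (tens_linearl _)); apply: memv_suml => i _.
rewrite (linear_sumZ _ _ _ (tens_linearr _)); apply: memvZ.
apply: memv_suml => j _; apply/memvZ/memv_span.
by apply: allpairs_f; apply: mem_nth; rewrite size_tuple.
Qed.

(** Closure of a subspace under the Hopf structure maps is thereby checked on generators only. *)
Lemma span_linear (V W : vectType k) (f : V -> W) X (U : {vspace W}) :
  linear f -> {in X, forall x, f x \in U} -> {in <<X>>%VS, forall v, f v \in U}.
Proof.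
move=> lf XU v vX; rewrite (coord_span (X := in_tuple X) vX).
rewrite (linear_sumZ _ _ _ lf); apply: memv_suml => i _.
by apply/memvZ/XU/mem_nth.
Qed.
End Linear.

(** * The axioms as equations between rows and columns of R *)

Section Rows.
Variables (k : fieldType) (I : finType) (H : hopfAlg k I).
Implicit Type R : vec k (I * I)%type.

(* [r] multiplies for [m] like the dual basis multiplies in the dual of [H] *)
Definition dual_family (m : vec k I -> vec k I -> vec k I) (r : I -> vec k I) :=
  forall i j, m (r i) (r j) = \sum_l hbcomul H l (i, j) *: r l.

Lemma leg13_tens (u v : vec k I) :
  leg13 H (u \ox v) = (u \ox aone H) \ox v.
Proof. by apply/ffunP => p; rewrite !ffunE /= mulrAC. Qed.

Lemma leg23_tens (u v : vec k I) :
  leg23 H (u \ox v) = (aone H \ox u) \ox v.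
Proof. by apply/ffunP => p; rewrite !ffunE /= mulrA. Qed.

Lemma leg13_linear : linear (leg13 H).
Proof. by move=> a u v; apply/ffunP => p; rewrite !ffunE mulrDl -mulrA. Qed.

Lemma leg23_linear : linear (leg23 H).
Proof. exact: linear_comp (@tassoc_linear _ _ _ _) (tens_linearr _). Qed.

(** With R = sum_a e_a (x) r_a, the product of e_a (x) 1 (x) r_a and 1 (x) e_b (x) r_b is e_a (x)
    e_b (x) r_a r_b, the units being absorbed. *)
Lemma amul_leg13_leg23 R i j l :
  amul (talg (talg H H) H) (leg13 H R) (leg23 H R) (i, j, l)
  = amul H (tens_row R i) (tens_row R j) l.
Proof.
rewrite {1 2}(sum_rows R) (linear_big_sum _ _ leg13_linear).
rewrite (linear_big_sum _ _ leg23_linear).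
rewrite (linear_big_sum _ _ (amul_linearl _ _)).
(* Bracketing to the right lets the coefficients at [i] and then at [j] be read off one after the
   other. *)
transitivity
  ((\sum_a bvec k a \ox
      (\sum_b bvec k b \ox amul H (tens_row R a) (tens_row R b))
    : vec k (I * (I * I))) (i, (j, l))); last first.
  by rewrite sum_bvec_tens sum_bvec_tens.
rewrite !sum_ffunE; apply: eq_bigr => a _.
rewrite (linear_big_sum _ _ (amul_linearr _ _)) !(sum_ffunE, ffunE) /= mulr_sumr.
apply: eq_bigr => b _; rewrite leg13_tens leg23_tens !amul_tens.
by rewrite (hmul1r (hopfP H)) (hmul1l (hopfP H)) !ffunE /= mulrA.
Qed.

(** The columns meet in the first tensor factor, and the factor R_13 stands on the left, hence the
    reversed order of [l] and [j]. *)
Lemma amul_leg13_leg12 R i j l :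
  amul (talg (talg H H) H) (leg13 H R) (leg12 H R) (i, j, l)
  = amul H (tens_row (tflip R) l) (tens_row (tflip R) j) i.
Proof.
rewrite {1 2}(sum_cols R) (linear_big_sum _ _ leg13_linear).
rewrite /leg12 (linear_big_sum _ _ (tens_linearl _)).
rewrite (linear_big_sum _ _ (amul_linearl _ _)).
transitivity
  ((\sum_b
      (\sum_a amul H (tens_row (tflip R) b) (tens_row (tflip R) a) \ox bvec k a)
    \ox bvec k b : vec k (I * I * I)) (i, j, l)); last first.
  by rewrite sum_tens_bvec sum_tens_bvec.
rewrite !sum_ffunE; apply: eq_bigr => b _.
rewrite (linear_big_sum _ _ (amul_linearr _ _)) !(sum_ffunE, ffunE) /= mulr_suml.
apply: eq_bigr => a _; rewrite leg13_tens !amul_tens.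
by rewrite (hmul1r (hopfP H)) (hmul1l (hopfP H)) !ffunE /=.
Qed.

Lemma comull_rows R :
  tmap (hcomul H) id R = amul (talg (talg H H) H) (leg13 H R) (leg23 H R)
  <-> dual_family (amul H) (tens_row R).
Proof.
have L i j l : tmap (hcomul H) id R (i, j, l)
    = (\sum_m hbcomul H m (i, j) *: tens_row R m) l.
  rewrite [R in LHS]sum_rows (linear_big_sum _ _ (tmap_linear _ _)) !sum_ffunE.
  apply: eq_bigr => m _; rewrite tmap_tens //; last exact: linext_linear.
  by rewrite /hcomul linext_bvec !ffunE.
split=> [e i j|e].
  by apply/ffunP => l; rewrite -amul_leg13_leg23 -e L.
by apply/ffunP => -[[i j] l]; rewrite amul_leg13_leg23 L e.
Qed.

Lemma comulr_rows R :
  tassoc (tmap id (hcomul H) R)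
    = amul (talg (talg H H) H) (leg13 H R) (leg12 H R)
  <-> dual_family (fun u v => amul H v u) (tens_row (tflip R)).
Proof.
have L i j l : tassoc (tmap id (hcomul H) R) (i, j, l)
    = (\sum_m hbcomul H m (j, l) *: tens_row (tflip R) m) i.
  rewrite [R in LHS]sum_cols (linear_big_sum _ _ (tmap_linear _ _)).
  rewrite ffunE !sum_ffunE.
  apply: eq_bigr => m _; rewrite tmap_tens //; last exact: linext_linear.
  by rewrite /hcomul linext_bvec !ffunE /= mulrC.
split=> [e i j|e].
  by apply/ffunP => l; rewrite -amul_leg13_leg12 -e L.
by apply/ffunP => -[[i j] l]; rewrite amul_leg13_leg12 L e.
Qed.

Lemma aone_neq0 : aone H <> 0.
Proof.
move=> h; have := hcounit1 (hopfP H); rewrite h /hcounit linext0.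
by move/esym/eqP; rewrite oner_eq0.
Qed.

Lemma quasitriangular_neq0 R : quasitriangular H R -> R <> 0.
Proof.
move=> /qt_inv[R' [RR' _]] R0; move: RR'; rewrite R0 amul0l => h.
(* The coefficient of 1 (x) 1 at [(i, i)] is the square of that of 1 at [i], so 1 (x) 1 = 0 would
   force 1 = 0, against epsilon(1) = 1. *)
apply: aone_neq0; apply/ffunP => i; apply/eqP; rewrite ffunE.
have /eqP := congr1 (fun v : vec k (I * I)%type => v (i, i)) h.
by rewrite !ffunE /= eq_sym mulf_eq0 orbb.
Qed.

Lemma cop_basis R :
  (forall i, amul (talg H H) R (hbcomul H i)
             = amul (talg H H) (tflip (hbcomul H i)) R)
  <-> forall h : vec k I, amul (talg H H) R (hcomul H h)
             = amul (talg H H) (tflip (hcomul H h)) R.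
Proof.
have lc : linear (hcomul H) := linext_linear _.
split=> [e|e i]; last by have := e (bvec k i); rewrite /hcomul linext_bvec.
apply: lin_ext => [||i].
- exact: linear_comp (amul_linearr _ _) lc.
- exact: linear_comp (amul_linearl _ _) (linear_comp (@tflip_linear _ _ _) lc).
- by rewrite /hcomul linext_bvec.
Qed.
End Rows.

(** * Exhaustive enumeration with pruning, and vectors over F_2 as sublists *)

Section Backtrack.
Variables (T : eqType) (ok : seq T -> bool) (c : seq T).

Definition backtrack (n : nat) : seq (seq T) :=
  iter n (fun L => [seq t <- [seq rcons s x | s <- L, x <- c] | ok t]) [:: [::]].

(** Pruning loses no solution as long as the test accepts all prefixes of a solution; the induction
    removes the last entry, as the loop appends at the end. *)
Lemma mem_backtrack s :
  (forall n, ok (take n s)) -> {subset s <= c} -> s \in backtrack (size s).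
Proof.
elim/last_ind: s => // s x IH oks sc; rewrite size_rcons /= mem_filter.
have := oks (size s).+1; rewrite take_oversize ?size_rcons // => -> /=.
apply: allpairs_f; last by rewrite sc ?mem_rcons ?mem_head.
apply: IH => [n|y ys]; last by rewrite sc // mem_rcons inE ys orbT.
have [lens|/ltnW/take_oversize ->] := leqP n (size s).
  by have := oks n; rewrite -cats1 takel_cat.
by have := oks (size s); rewrite -cats1 take_size_cat.
Qed.
End Backtrack.

Fixpoint sublists (T : Type) (e : seq T) : seq (seq T) :=
  if e is x :: e' then sublists e' ++ map (cons x) (sublists e') else [:: [::]].

Lemma filter_sublists (T : eqType) (P : pred T) e : filter P e \in sublists e.
Proof.
elim: e => //= x e IH; rewrite mem_cat; case: (P x); last by rewrite IH.
by rewrite map_f ?orbT.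
Qed.

Lemma veqE (I : finType) (l m : seq I) : veq l m <-> sumb l = sumb m.
Proof.
split=> [|e]; first exact: veqP.
(* Doubling the coefficient and replacing one copy by its equal makes the total count in [l ++ m]
   agree mod 2 with an even number. *)
apply/allP => i _; have := congr1 (fun u : vec 'F_2 I => u i + u i) e.
rewrite {2}e !sumbE -!natrD F2_odd [in RHS]F2_odd count_cat.
by rewrite addnn odd_double; case: odd.
Qed.

Lemma F2_neq0 (a : 'F_2) : a = (a != 0)%:R.
Proof. by apply: val_inj; case: a => -[|[|]]. Qed.

(** * The boolean tests and their equivalence with the axioms *)

Section Search.
Variables (I : finType) (H : hopfAlg 'F_2 I) (e : seq I).
Variables (gm : I -> I -> seq I) (g1 : seq I) (gc : I -> seq (I * I)%type).
Variables (ge : I -> nat) (gs : I -> seq I).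
Hypothesis P : presented H e gm g1 gc ge gs.
Hypothesis e_uniq : uniq e.

(* A table [s] stands for the element [sumb (entries s)] of [H (x) H]. *)
Definition rows (s : seq (seq I)) (i : I) : seq I := nth [::] s (index i e).
Definition cols s (j : I) : seq I := [seq i <- e | odd (count_mem j (rows s i))].
Definition entries s : seq (I * I)%type :=
  lext (fun i => [seq (i, j) | j <- rows s i]) e.

(** The product of the dual basis vectors at [i] and [j] in H^*, as a set of dual basis vectors. *)
Definition coeff_ones i j : seq I := [seq l <- e | odd (count_mem (i, j) (gc l))].

Definition family_check (m : seq I -> seq I -> seq I) (known : pred I) r : bool :=
  all (fun i => all (fun j =>
    all known [:: i, j & coeff_ones i j]
    ==> veq (m (r i) (r j)) (lext r (coeff_ones i j))) e) e.

(* [s] may be partial: relations that involve a missing row are not tested. *)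
Definition rows_check s : bool :=
  family_check (lmul gm) (fun i => index i e < size s)%N (rows s).

Definition cols_check s : bool :=
  family_check (fun l m => lmul gm m l) predT (cols s).

Definition lswap (l : seq (I * I)%type) := [seq (p.2, p.1) | p <- l].

Definition cop_check s : bool :=
  all (fun i => veq (lmul2 gm (entries s) (gc i))
                    (lmul2 gm (lswap (gc i)) (entries s))) e.

Definition candidates : seq (seq (seq I)) :=
  [seq s <- backtrack rows_check (sublists e) (size e)
  | cols_check s && cop_check s].

Lemma sum_indicator (V : lmodType 'F_2) (a : pred I) (c : I -> 'F_2)
    (v : I -> V) :
  (forall i, c i = (a i)%:R) -> \sum_i c i *: v i = \sum_(i <- e | a i) v i.
Proof.
move=> ca; have pe' : perm_eq (index_enum I) e.
  apply: uniq_perm; rewrite ?index_enum_uniq // => i.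
  by rewrite mem_index_enum (pe P).
rewrite (perm_big e pe') [RHS]big_mkcond; apply: eq_bigr => i _.
by rewrite ca; case: (a i); rewrite ?scale1r ?scale0r.
Qed.

Lemma sumb_indicator (a : pred I) (v : vec 'F_2 I) :
  (forall i, v i = (a i)%:R) -> v = sumb [seq i <- e | a i].
Proof.
by move=> va; rewrite {1}(bvec_sum v) (sum_indicator _ va) /sumb big_filter.
Qed.

Lemma family_checkP m f r :
  (forall a b, f (sumb a) (sumb b) = sumb (m a b)) ->
  family_check m predT r <-> dual_family H f (fun i => sumb (r i)).
Proof.
move=> mf; have S i j : \sum_l hbcomul H l (i, j) *: sumb (r l)
    = sumb (lext r (coeff_ones i j)).
  rewrite (sum_indicator (a := fun l => odd (count_mem (i, j) (gc l)))); last first.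
    by move=> l; rewrite (pc P) sumbE; exact: F2_odd.
  rewrite -big_filter -/(coeff_ones i j).
  elim: (coeff_ones i j) => [|l s IH]; first by rewrite big_nil sumb0.
  by rewrite big_cons IH -sumb_cat.
split=> [c i j|c].
  rewrite mf S; apply/veqP.
  move/allP: c => /(_ i (pe P i))/allP/(_ j (pe P j)).
  by rewrite /= all_predT.
apply/allP => i _; apply/allP => j _; rewrite /= all_predT /=.
by apply/veqE; rewrite -mf c S.
Qed.

Lemma tflip_sumb l : tflip (sumb l) = sumb (lswap l) :> vec 'F_2 (I * I)%type.
Proof.
rewrite /sumb (linear_big_sum _ _ (@tflip_linear _ _ _)) big_map.
apply: eq_bigr => -[i j] _; rewrite -!tens_bvec.
by apply/ffunP => p; rewrite !ffunE mulrC.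
Qed.

Lemma row_entries s : tens_row (sumb (entries s)) =1 fun i => sumb (rows s i).
Proof.
have -> : sumb (entries s) = \sum_i bvec 'F_2 i \ox sumb (rows s i).
  rewrite [RHS](eq_bigr (fun i => 1 *: (bvec 'F_2 i \ox sumb (rows s i)))).
    rewrite (sum_indicator (a := predT)) // /entries.
    elim: e => [|i r IH]; first by rewrite big_nil sumb0.
    rewrite big_cons -IH [LHS]sumb_cat -sumb1 tens_sumb /=; congr (sumb _ + _).
    by rewrite cats0.
  by move=> i _; rewrite scale1r.
by move=> i; apply/ffunP => j; rewrite ffunE sum_bvec_tens.
Qed.

Lemma col_entries s :
  tens_row (tflip (sumb (entries s))) =1 fun j => sumb (cols s j).
Proof.
move=> j; apply: sumb_indicator => i; have := row_entries s i.
by move/(congr1 (fun v : vec 'F_2 I => v j)); rewrite !ffunE sumbE -F2_odd /= => <-.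
Qed.

Lemma eq_dual_family m (r r' : I -> vec 'F_2 I) :
  r =1 r' -> dual_family H m r -> dual_family H m r'.
Proof. by move=> rr' d i j; rewrite -!rr' d; apply: eq_bigr => l _; rewrite rr'. Qed.

(** Each row is encoded by its support, listed in the order of [e]; over F_2 the support determines
    the row. *)
Lemma entries_onto R : exists2 s, all (mem (sublists e)) s &
  size s = size e /\ R = sumb (entries s).
Proof.
exists [seq [seq j <- e | R (i, j) != 0] | i <- e].
  by apply/allP => _ /mapP[i _ ->]; exact: filter_sublists.
split; first exact: size_map.
rewrite [LHS]sum_rows [RHS]sum_rows; apply: eq_bigr => i _; congr (_ \ox _).
rewrite row_entries /rows (nth_map i) ?index_mem ?(pe P) // nth_index ?(pe P) //.
by apply: sumb_indicator => j; rewrite ffunE; exact: F2_neq0.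
Qed.

(** A relation tested on a truncated table involves only rows that are present, and these agree with
    the rows of [s]; this is what [mem_backtrack] asks for. *)
Lemma rows_check_take n s :
  family_check (lmul gm) predT (rows s) -> rows_check (take n s).
Proof.
move=> /allP c; apply/allP => i ie; apply/allP => j je.
have /allP/(_ j je) := c i ie; rewrite all_predT /= => h.
apply/implyP => /= /and3P[ki kj /allP kl].
have E l : (index l e < size (take n s))%N -> rows (take n s) l = rows s l.
  rewrite size_take_min ltn_min => /andP[ln _]; exact: nth_take.
rewrite !E //; move: h; congr (veq _ _ : Prop); congr flatten.
by apply/eq_in_map => l /kl /E.
Qed.

Lemma quasitriangular_candidates R :
  quasitriangular H R -> exists2 s, s \in candidates & R = sumb (entries s).
Proof.
have [s /allP ss [sz ->] qR] := entries_onto R; exists s => //.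
rewrite mem_filter -sz mem_backtrack //; last first.
  move=> n; apply: rows_check_take; apply/(family_checkP (rows s) (hmul_sumb P)).
  exact: eq_dual_family (row_entries s) ((comull_rows H _).1 (qt_comull qR)).
rewrite andbT; apply/andP; split.
  apply/(family_checkP (f := fun u v => amul H v u) (cols s)
    (fun a b => hmul_sumb P b a)).
  exact: eq_dual_family (col_entries s) ((comulr_rows H _).1 (qt_comulr qR)).
apply/allP => i _; apply/veqE.
have := (cop_basis H _).2 (qt_cop qR) i.
by rewrite (pc P) tflip_sumb !(hmul2_sumb P).
Qed.

(** Reduces a classification to one evaluation. The alternative [[::]] is R = 0, which satisfies all
    the tested equations and fails only invertibility. *)
Lemma quasitriangular_search (Q : pred (seq (I * I)%type)) :
  all (fun s => veq (entries s) [::] || Q (entries s)) candidates ->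
  forall R, quasitriangular H R -> exists2 l, Q l & R = sumb l.
Proof.
move=> /allP cQ R qR; have [s /cQ/orP[/veqP s0|Qs] Rs] :=
  quasitriangular_candidates qR; last by exists (entries s).
by case: (quasitriangular_neq0 qR); rewrite Rs s0 sumb0.
Qed.

Definition triangular_check s : bool :=
  veq (lmul2 gm (lswap (entries s)) (entries s)) [seq (i, j) | i <- g1, j <- g1].

Lemma triangular_checkP s :
  triangular H (sumb (entries s)) <-> triangular_check s.
Proof.
by rewrite /triangular tflip_sumb (hmul2_sumb P) (p1 P) tens_sumb; split=> /veqE.
Qed.

Lemma quasitriangular_check s :
  [&& family_check (lmul gm) predT (rows s), cols_check s, cop_check s
    & triangular_check s] -> quasitriangular H (sumb (entries s)).
Proof.
case/and4P=> rs cs ps /triangular_checkP ts; split.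
- exists (tflip (sumb (entries s))); split; last exact: ts.
  have := congr1 (@tflip _ _ _) ts; rewrite tflip_amul.
  have -> (u : vec 'F_2 (I * I)%type) : tflip (tflip u) = u.
    by apply/ffunP => -[i j]; rewrite !ffunE.
  by move=> ->; apply/ffunP => p; rewrite !ffunE mulrC.
- apply/comull_rows.
  apply: eq_dual_family (fun i => esym (row_entries s i)) _.
  exact/(family_checkP (rows s) (hmul_sumb P)).
- apply/comulr_rows.
  apply: eq_dual_family (fun i => esym (col_entries s i)) _.
  exact/(family_checkP (f := fun u v => amul H v u) (cols s)
    (fun a b => hmul_sumb P b a)).
- apply/cop_basis => i; rewrite (pc P) tflip_sumb !(hmul2_sumb P).
  by move/allP: ps => /(_ i (pe P i))/veqP.
Qed.
End Search.

(** * The three Hopf algebras *)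

Local Notation ones l := [seq (o4 p.1, o4 p.2) | p <- (l : seq (nat * nat))%N].

(** The search leaves only R = 0. Conceptually, c[B_+] is commutative, so an invertible R could be
    cancelled from R Delta = Delta^cop R, while Delta y is not symmetric. *)
Lemma no_quasitriangular_cBp R : ~ quasitriangular cBp R.
Proof.
by case/(quasitriangular_search (H := cBp) cBp_presented isT (Q := pred0)).
Qed.

Definition cBpd_R : vec 'F_2 ('I_4 * 'I_4)%type :=
  aone cBpd \ox aone cBpd + b4 (isT : 2 < 4)%N \ox b4 (isT : 2 < 4)%N.

Lemma cBpd_RE : cBpd_R = sumb (ones [:: (0, 0); (2, 2)]).
Proof. by rewrite /cBpd_R /aone /= /b4 !tens_bvec -!sumb1 -sumb_cat. Qed.

(** The trivial structure does occur here, since c[B_+]^* is cocommutative. *)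
Lemma cBpd_search R :
  quasitriangular cBpd R -> R = aone cBpd \ox aone cBpd \/ R = cBpd_R.
Proof.
case/(quasitriangular_search (H := cBpd) cBpd_presented isT (Q := fun l =>
  veq l (ones [:: (0, 0)]) || veq l (ones [:: (0, 0); (2, 2)]))).
  by vm_compute.
rewrite cBpd_RE => l /orP[] /veqP le ->; [left|by right].
by rewrite le /aone /= /b4 tens_bvec -sumb1.
Qed.

Lemma cBpd_R_quasitriangular : quasitriangular cBpd cBpd_R.
Proof.
have := quasitriangular_check (H := cBpd) cBpd_presented isT
  (* The rows of 1 (x) 1 + w (x) w at 1, x, w, y. *)
  (s := [:: [:: o4 0]; [::]; [:: o4 2]; [::]]).
by rewrite cBpd_RE; apply; vm_compute.
Qed.

Lemma cBpd_R_triangular : triangular cBpd cBpd_R.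
Proof.
have [_] := triangular_checkP (H := cBpd) cBpd_presented
  [:: [:: o4 0]; [::]; [:: o4 2]; [::]].
by rewrite cBpd_RE; apply; vm_compute.
Qed.

(* The rows of [dsl2_R], expanded in the basis 1, s, x, w *)
Definition dsl2_rows (b : bool) : seq (seq 'I_4) :=
  if b then [:: map o4 [:: 1; 3]; map o4 [:: 0; 1; 3]; map o4 [:: 0; 1; 2; 3];
                map o4 [:: 2; 3]]%N
  else [:: map o4 [:: 0; 3]; map o4 [:: 3]; map o4 [:: 0; 1; 2; 3];
           map o4 [:: 2; 3]]%N.

Lemma dsl2_RE (b : bool) : dsl2_R b%:R = sumb (entries all4 (dsl2_rows b)).
Proof.
rewrite /dsl2_R /b4 -!sumb1 -!sumb_cat !tens_sumb scale_sumb -!sumb_cat.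
by apply: veqP; case: b; vm_compute.
Qed.

Lemma dsl2_search R : quasitriangular dsl2 R -> exists b : bool, R = dsl2_R b%:R.
Proof.
case/(quasitriangular_search (H := dsl2) dsl2_presented isT (Q := fun l =>
  has (fun b => veq l (entries all4 (dsl2_rows b))) [:: false; true])).
  by vm_compute.
by move=> l /hasP[b _ /veqP lb] ->; exists b; rewrite dsl2_RE.
Qed.

Lemma dsl2_R_quasitriangular (b : bool) : quasitriangular dsl2 (dsl2_R b%:R).
Proof.
rewrite dsl2_RE; apply: (quasitriangular_check (H := dsl2) dsl2_presented isT).
by case: b; vm_compute.
Qed.

Lemma dsl2_R_triangular (b : bool) : triangular dsl2 (dsl2_R b%:R).
Proof.
rewrite dsl2_RE; apply/(triangular_checkP (H := dsl2) dsl2_presented).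
by case: b; vm_compute.
Qed.

Lemma dsl2_R_nontrivial (b : bool) : nontrivial dsl2 (dsl2_R b%:R).
Proof.
rewrite /nontrivial dsl2_RE (p1 dsl2_presented) tens_sumb => /veqE.
by case: b; vm_compute.
Qed.

Lemma w_grassmann_line :
  grassmann_line cBpd <<[:: aone cBpd; b4 (isT : 2 < 4)%N]>>%VS
    (b4 (isT : 2 < 4)%N).
Proof.
set g := b4 _; set X := [:: _; _]; set U := (<<X>>)%VS.
have oneU : aone cBpd \in U by apply: memv_span; rewrite mem_head.
have gU : g \in U by apply: memv_span; rewrite !inE eqxx orbT.
have gg : amul cBpd g g = 0 by rewrite amul_bvec.
have gprim : primitive cBpd g by rewrite /primitive /hcomul linext_bvec.
have XP x : x \in X -> x = aone cBpd \/ x = g.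
  by rewrite !inE => /orP[] /eqP; [left | right].
have mul1 := hmul1l cBpd_hopf; have mul1r := hmul1r cBpd_hopf.
split=> //; first split=> //.
- move=> a b aU bU; move: a aU.
  apply: (span_linear (amul_linearl _ _)) => a /XP[->|->].
    by rewrite mul1.
  move: b bU; apply: (span_linear (amul_linearr _ _)) => b /XP[->|->].
    by rewrite mul1r.
  by rewrite gg mem0v.
- apply: (span_linear (linext_linear _)) => x /XP[->|->].
    by rewrite -/(hcomul _ _) (hcomul1 cBpd_hopf) mem_tensv.
  by rewrite -/(hcomul _ _) gprim memvD ?mem_tensv.
- by apply: (span_linear (linext_linear _)) => x /XP[->|->]; rewrite linext_bvec.
(* Independence: w is nonzero at its own coordinate, and a multiple of w vanishes at the coordinate
   of 1. *)
- rewrite /basis_of eqxx /= free_cons span_seq1 seq1_free.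
  apply/andP; split; last first.
    by apply/eqP => /ffunP/(_ (o4 2)); rewrite !ffunE.
  by apply/negP => /vlineP[c /ffunP/(_ (o4 0))]; rewrite !ffunE /= scaler0.
Qed.

Lemma cBpd_R_nontrivial : nontrivial cBpd cBpd_R.
Proof.
by rewrite /nontrivial cBpd_RE (p1 cBpd_presented) tens_sumb => /veqE.
Qed.

Theorem proposition6p3 :
  (forall R : vec 'F_2 ('I_4 * 'I_4)%type, ~ quasitriangular cBp R) /\
  (exists R : vec 'F_2 ('I_4 * 'I_4)%type,
    unique (fun R' => quasitriangular cBpd R' /\ nontrivial cBpd R') R /\
    triangular cBpd R /\
    exists (U : {vspace vec 'F_2 'I_4}) (g : vec 'F_2 'I_4),
      grassmann_line cBpd U g /\ R = aone cBpd \ox aone cBpd + g \ox g) /\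
  ((forall R : vec 'F_2 ('I_4 * 'I_4)%type,
      quasitriangular dsl2 R <-> R = dsl2_R 0 \/ R = dsl2_R 1) /\
   dsl2_R 0 <> dsl2_R 1 /\
   (forall alpha : 'F_2,
      nontrivial dsl2 (dsl2_R alpha) /\ triangular dsl2 (dsl2_R alpha))).
Proof.
split; first exact: no_quasitriangular_cBp.
split.
  exists cBpd_R; split; last split; first split.
  - exact: (conj cBpd_R_quasitriangular cBpd_R_nontrivial).
  - by move=> R [/cBpd_search[]].
  - exact: cBpd_R_triangular.
  - by exists <<[:: aone cBpd; b4 (isT : 2 < 4)%N]>>%VS, (b4 (isT : 2 < 4)%N);
      split; first exact: w_grassmann_line.
split; [move=> R; split | split].
- by case/dsl2_search => -[] ->; [right|left].
- case=> ->; first exact: (dsl2_R_quasitriangular false).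
  exact: (dsl2_R_quasitriangular true).
- rewrite (dsl2_RE false) (dsl2_RE true) => /veqE.
  by vm_compute.
- move=> a; rewrite (F2_neq0 a); split.
    exact: dsl2_R_nontrivial.
  exact: dsl2_R_triangular.
Qed.
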